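(* Let $m\ge 1$ be an integer. Let $(P_t)_{t\in[0,T]}$ be a semigroup of linear operators satisfying Assumption $(\mathcal M_P)$, and let $(Q_t)_{t\in[0,T]}$ be a family of linear operators. Assume that both $P_t$ and $Q_t$ satisfy $(\mathcal M)$ and $\mathcal R(m,\delta_m)$, and that $J_{\le m}(P_t-Q_t)=0$, i.e. $J_{\le m}(P_t)=J_{\le m}(Q_t)$. Then for every $p\ge 2$, every $x\in\mathbf R^N$ and every $f\in C_p^{2(m+1)}$ there exists a constant $K=K(T,x)>0$ (independent of $n$) such that for all integers $n\ge 1$ $$|P_Tf(x)-(Q_{T/n})^nf(x)|\le K\,\delta_m\!\left(\frac Tn\right)\|f\|_{C_p^{2(m+1)}}.$$
   Context: Fix $T>0$ and $N\ge 1$. For $p\ge 0$ and an integer $m\ge 0$, $C_p^m=C_p^m(\mathbf R^N)$ is the set of $C^m$ functions $f:\mathbf R^N\to\mathbf R$ such that for each multi-index $\alpha$ with $0\le|\alpha|\le m$ there is $C(\alpha)$ with $|\partial_x^\alpha f(x)|\le C(\alpha)(1+|x|^p)$; $C_p=C_p^0$. The norm is $\|f\|_{C_p^m}=\inf\{C\ge 0: |\partial_x^\alpha f(x)|\le C(1+|x|^p),\ 0\le|\alpha|\le m,\ x\in\mathbf R^N\}$. $C_p^{1,m}([0,T]\times\mathbf R^N)$ is the set of $f:[0,T]\times\mathbf R^N\to\mathbf R$ such that $s\mapsto f(s,x)$ is continuously differentiable for all $x$ and $f(s,\cdot),\partial_sf(s,\cdot)\in C_p^m$ with $\sup_{s\in[0,T]}(\|f(s,\cdot)\|_{C_p^m}+\|\partial_sf(s,\cdot)\|_{C_p^m})<\infty$.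 All operators $Q_t$ ($0\le t\le T$) are linear maps from $\bigcup_{p\ge0}C_p$ to itself. A semigroup means $P_0=I$ and $P_{s+t}=P_sP_t$ whenever $s,t,s+t\in[0,T]$. $(\mathcal M_0)$: for $p\ge2$ and $f\in C_p$, $Q_tf\in C_p$ and $\sup_{t\in[0,T]}\|Q_tf\|_{C_p}\le K\|f\|_{C_p}$ for some constant $K>0$ (independent of $f$ and of $n$); moreover $0\le Q_tf(x)\le Q_tg(x)$ whenever $0\le f\le g$. $(\mathcal M)$: $Q_t$ satisfies $(\mathcal M_0)$ and for each $p\in\mathbf N$, with $f_p(x)=|x|^{2p}$, there are constants $K=K(T,p),K'=K'(T,p)>0$ with $Q_tf_p(x)\le(1+Kt)f_p(x)+K't$ for all $t\in[0,T]$, $x\in\mathbf R^N$. $\delta_m:[0,T]\to\mathbf R_+$ denotes a nondecreasing function with $\limsup_{t\to0+}\delta_m(t)/t^{m-1}=0$ (usually $\delta_m(t)=t^m$). $\mathcal R(m,\delta_m)$: for each $p\ge2$ there exist a constant $q=q(m,p)\ge p$ and linear operators $e_k:C_p^{2k}\to C_{p+2k}$ ($k=0,\dots,m$) such that: (A) for every $1\le m'\le m$ and $f\in C_p^{2(m'+1)}$, $Q_tf(x)=\sum_{k=0}^{m'}(e_kf)(x)t^k+(\mathrm{Err}_t^{(m')}f)(x)$, $t\in[0,T]$, with $\mathrm{Err}_t^{(m')}f\in C_q$; (B) if $f\in C_p^{m''}$ with $m''\ge2k$, then $e_kf\in C_{p+2k}^{m''-2k}$ and $\|e_kf\|_{C_{p+2k}^{m''-2k}}\le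 K\|f\|_{C_p^{m''}}$ ($k=0,\dots,m$) for a constant $K=K(T,m)>0$; furthermore if $f\in C_p^{m''}$ with $m''\ge2m'+2$, then for all $0\le t\le T$, $\|\mathrm{Err}_t^{(m')}f\|_{C_q}\le Kt^{m'+1}\|f\|_{C_p^{m''}}$ if $m'<m$, and $\le Kt\,\delta_m(t)\|f\|_{C_p^{m''}}$ if $m'=m$; (C) for every $0\le k\le m$ and $j\ge2k+2$, if $f\in C_p^{1,j}([0,T]\times\mathbf R^N)$ then $e_kf\in C_{p+2k}^{1,j-2k}([0,T]\times\mathbf R^N)$ ($e_k$ acting in the space variable). $J_{\le m}(Q_t):=\sum_{k=0}^mt^ke_k$; $J_{\le m}$ of a linear combination of operators is the corresponding linear combination. $(\mathcal M_P)$: for every $p\ge2$ and integer $m\ge2$ and all $f\in C_p^m$, $(t,x)\mapsto P_tf(x)$ belongs to $C_{p+2}^{1,m-2}([0,T]\times\mathbf R^N)$, and for some constant $C>0$ (independent of $f,s,t$): (1) $\sup_{t\in[0,T]}\|P_tf\|_{C_p^m}\le C\|f\|_{C_p^m}$; (2) $\|(P_t-P_s)f\|_{C_{p+2}^{m-2}}\le C|t-s|\,\|f\|_{C_p^m}$ for $s,t\in[0,T]$. *)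

(* Defs.v *)
From mathcomp Require Import all_boot all_order all_algebra.
From mathcomp Require Import all_classical all_reals all_analysis.

Set Implicit Arguments.
Unset Strict Implicit.
Unset Printing Implicit Defensive.

Import Order.TTheory GRing.Theory Num.Theory.
Import numFieldNormedType.Exports.

Local Open Scope classical_set_scope.
Local Open Scope ring_scope.

(* MathComp-Analysis norms 'rV[R]_N by the sup norm (with the same topology);
   the growth conditions use the Euclidean norm. *)
Definition enorm (R : realType) (N : nat) (x : 'rV[R]_N) : R :=
  Num.sqrt (\sum_(i < N) x 0 i ^+ 2).

Definition partial (R : realType) (N : nat) (i : 'I_N)
    (f : 'rV[R]_N -> R) : 'rV[R]_N -> R :=
  'D_(delta_mx 0 i) f.

Definition mdegree (N : nat) (alpha : {ffun 'I_N -> nat}) : nat :=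
  (\sum_(i < N) alpha i)%N.

(* The order of differentiation is fixed here; it is immaterial for the
   C^m functions, |alpha| <= m, to which this is applied. *)
Definition mpartial (R : realType) (N : nat) (alpha : {ffun 'I_N -> nat})
    (f : 'rV[R]_N -> R) : 'rV[R]_N -> R :=
  foldr (fun i g => iter (alpha i) (partial i) g) f (enum 'I_N).

Fixpoint classC (R : realType) (N : nat) (m : nat) (f : 'rV[R]_N -> R) : Prop :=
  match m with
  | 0 => continuous f
  | m'.+1 => continuous f /\
      forall i : 'I_N,
        (forall x, derivable f x (delta_mx 0 i)) /\ classC m' (partial i f)
  end.

Definition Cpm (R : realType) (N : nat) (p : R) (m : nat) :
    set ('rV[R]_N -> R) :=
  [set f | classC m f /\
    forall alpha : {ffun 'I_N -> nat}, (mdegree alpha <= m)%N ->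
      exists C : R, forall x, `|mpartial alpha f x| <= C * (1 + enorm x `^ p)].

(* Real-valued [inf] is 0 on the empty set, so this is the norm only on
   [Cpm p m]; membership is always asserted separately. *)
Definition Cpm_norm (R : realType) (N : nat) (p : R) (m : nat)
    (f : 'rV[R]_N -> R) : R :=
  inf [set C : R | 0 <= C /\
    forall alpha : {ffun 'I_N -> nat}, (mdegree alpha <= m)%N ->
      forall x, `|mpartial alpha f x| <= C * (1 + enorm x `^ p)].

Definition Cpoly (R : realType) (N : nat) : set ('rV[R]_N -> R) :=
  [set f | exists p : R, 0 <= p /\ Cpm p 0 f].

(* A time-dependent function is a total function of which only the restriction
   to times in [0, T] matters; hence derivatives in time are limits within
   [0, T], one-sided at the end points. *)
Definition C1pm (R : realType) (N : nat) (T p : R) (m : nat) :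
    set (R -> 'rV[R]_N -> R) :=
  [set f | exists df : R -> 'rV[R]_N -> R,
    [/\ forall (s : R) x, s \in `[0, T] ->
          (f u x - f s x) / (u - s) @[u --> within `[0, T] s^'] --> df s x,
        forall x, {within `[0, T], continuous (fun s => df s x)},
        forall s : R, s \in `[0, T] -> Cpm p m (f s) /\ Cpm p m (df s)
      & exists M : R, forall s : R, s \in `[0, T] ->
          Cpm_norm p m (f s) + Cpm_norm p m (df s) <= M]].

(* A linear operator between function spaces [D] and [D'] is encoded as a total
   map on functions, constrained on [D] only. *)
Definition linear_from_to (R : realType) (N : nat)
    (D D' : set ('rV[R]_N -> R)) (L : ('rV[R]_N -> R) -> 'rV[R]_N -> R) : Prop :=
  (forall f, D f -> D' (L f)) /\
  forall (a : R) f g, D f -> D g ->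
    L (fun x => a * f x + g x) = (fun x => a * L f x + L g x).

Definition operator_family (R : realType) (N : nat) (T : R)
    (Q : R -> ('rV[R]_N -> R) -> 'rV[R]_N -> R) : Prop :=
  forall t : R, t \in `[0, T] -> linear_from_to (@Cpoly R N) (@Cpoly R N) (Q t).

Definition semigroup (R : realType) (N : nat) (T : R)
    (P : R -> ('rV[R]_N -> R) -> 'rV[R]_N -> R) : Prop :=
  (forall f, Cpoly f -> P 0 f = f) /\
  forall (s t : R) f, s \in `[0, T] -> t \in `[0, T] -> s + t \in `[0, T] ->
    Cpoly f -> P (s + t) f = P s (P t f).

Definition assumption_M0 (R : realType) (N : nat) (T : R)
    (Q : R -> ('rV[R]_N -> R) -> 'rV[R]_N -> R) : Prop :=
  (forall p : R, 2 <= p -> exists K : R, 0 < K /\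
     forall f, Cpm p 0 f -> forall t : R, t \in `[0, T] ->
       Cpm p 0 (Q t f) /\ Cpm_norm p 0 (Q t f) <= K * Cpm_norm p 0 f) /\
  (forall f g, Cpoly f -> Cpoly g -> (forall x, 0 <= f x <= g x) ->
     forall (t : R) x, t \in `[0, T] -> 0 <= Q t f x <= Q t g x).

Definition assumption_M (R : realType) (N : nat) (T : R)
    (Q : R -> ('rV[R]_N -> R) -> 'rV[R]_N -> R) : Prop :=
  assumption_M0 T Q /\
  forall p : nat, exists K K' : R, [/\ 0 < K, 0 < K' &
    forall (t : R) x, t \in `[0, T] ->
      Q t (fun y => enorm y ^+ (2 * p)) x <=
        (1 + K * t) * enorm x ^+ (2 * p) + K' * t].

Definition admissible_rate (R : realType) (T : R) (m : nat) (delta : R -> R) :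
    Prop :=
  [/\ forall t : R, t \in `[0, T] -> 0 <= delta t,
      {in `[0, T] &, {homo delta : s t / s <= t}}
    & limf_esup (fun t => (delta t / t ^+ m.-1)%:E) (0^'+) = 0%E].

Definition Jle (R : realType) (N : nat) (m : nat)
    (e : nat -> ('rV[R]_N -> R) -> 'rV[R]_N -> R) (t : R)
    (f : 'rV[R]_N -> R) : 'rV[R]_N -> R :=
  fun x => \sum_(k < m.+1) t ^+ k * e k f x.

Definition Err (R : realType) (N : nat)
    (Q : R -> ('rV[R]_N -> R) -> 'rV[R]_N -> R)
    (e : nat -> ('rV[R]_N -> R) -> 'rV[R]_N -> R)
    (m' : nat) (t : R) (f : 'rV[R]_N -> R) : 'rV[R]_N -> R :=
  fun x => Q t f x - Jle m' e t f x.

(* Condition R(m, delta) for [Q], with the coefficient operators explicit: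
   [e p k] is the operator e_k : C_p^{2k} -> C_{p+2k} provided for the growth
   exponent p, so that [Jle m (e p) t] is J_{<= m}(Q_t). *)
Definition assumption_R (R : realType) (N : nat) (T : R) (m : nat)
    (delta : R -> R) (Q : R -> ('rV[R]_N -> R) -> 'rV[R]_N -> R)
    (e : R -> nat -> ('rV[R]_N -> R) -> 'rV[R]_N -> R) : Prop :=
  forall p : R, 2 <= p -> exists q : R, p <= q /\
  [/\ forall k, (k <= m)%N ->
        linear_from_to (Cpm p (2 * k)) (Cpm (p + (2 * k)%:R) 0) (e p k),
      forall m' f (t : R), (1 <= m' <= m)%N -> Cpm p (2 * m'.+1) f ->
        t \in `[0, T] -> Cpm q 0 (Err Q (e p) m' t f),
      forall m'' : nat, exists K : R, [/\ 0 < K,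
        forall k f, (k <= m)%N -> (2 * k <= m'')%N -> Cpm p m'' f ->
          Cpm (p + (2 * k)%:R) (m'' - 2 * k) (e p k f) /\
          Cpm_norm (p + (2 * k)%:R) (m'' - 2 * k) (e p k f)
            <= K * Cpm_norm p m'' f
      & forall m' f (t : R), (1 <= m' <= m)%N -> (2 * m' + 2 <= m'')%N ->
          Cpm p m'' f -> t \in `[0, T] ->
          Cpm_norm q 0 (Err Q (e p) m' t f) <=
            K * (if (m' < m)%N then t ^+ m'.+1 else t * delta t)
              * Cpm_norm p m'' f]
    & forall k j f, (k <= m)%N -> (2 * k + 2 <= j)%N -> C1pm T p j f ->
        C1pm T (p + (2 * k)%:R) (j - 2 * k) (fun s => e p k (f s))].

Definition assumption_MP (R : realType) (N : nat) (T : R)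
    (P : R -> ('rV[R]_N -> R) -> 'rV[R]_N -> R) : Prop :=
  forall (p : R) (m : nat), 2 <= p -> (2 <= m)%N ->
  exists C : R, 0 < C /\ forall f, Cpm p m f ->
  [/\ C1pm T (p + 2) (m - 2) (fun t => P t f),
      forall t : R, t \in `[0, T] ->
        Cpm p m (P t f) /\ Cpm_norm p m (P t f) <= C * Cpm_norm p m f
    & forall s t : R, s \in `[0, T] -> t \in `[0, T] ->
        Cpm_norm (p + 2) (m - 2) (fun x => P t f x - P s f x)
          <= C * `|t - s| * Cpm_norm p m f].

(* Main.v *)
Require Import Defs.
From mathcomp Require Import all_boot all_order all_algebra.
From mathcomp Require Import all_classical all_reals all_analysis.
From mathcomp Require Import ring lra.

(** The proof is the Lax scheme: consistency and stability give convergence.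
Put h = T/n and D_k = P_{kh} f - Q_h^k f. The semigroup property of P gives
the recursion

      D_{k+1} = (P_h - Q_h) P_{kh} f + Q_h D_k,      D_0 = 0.

Everything is measured against a weight w(y) = 1 + |y|^{2r}.

Consistency ([local_error]): since J_{<= m}(P_h) = J_{<= m}(Q_h), the first
m + 1 terms of the expansions of P_h g and Q_h g cancel, and (P_h - Q_h) g is
a difference of two remainders, hence bounded by a constant times
h delta(h) ||g|| w, as soon as r is so large that w dominates the growth of
both remainders. It is applied to g = P_{kh} f, whose norm is bounded by that
of f uniformly in k because P satisfies (M_P).

Stability ([weight_growth], [weight_step]): w is the sum of the functions f_r
and f_0 = 1 of Assumption (M), so Q_h w <= (1 + L h) w. As Q_h is linear and
preserves order, |D| <= c w implies |Q_h D| <= c (1 + L h) w.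

Inserting both into the recursion, |D_n| <= n eps (1 + L h)^n w where eps is
the one-step error ([semigroup_iter_error]). Here (1 + L h)^n <= exp (L T),
and n eps is T delta(h) ||f|| up to a constant since n h = T: the sum over n
steps consumes exactly one factor h of the one-step error. *)

Set Implicit Arguments.
Unset Strict Implicit.
Unset Printing Implicit Defensive.

Import Order.TTheory GRing.Theory Num.Theory.
Import numFieldNormedType.Exports.

Local Open Scope classical_set_scope.
Local Open Scope ring_scope.

(** * Polynomial growth *)

Section Growth.
Context {R : realType} {N : nat}.
Implicit Types (f g : 'rV[R]_N -> R) (p q : R) (m : nat).

Lemma enorm_ge0 (y : 'rV[R]_N) : 0 <= enorm y.
Proof. exact: sqrtr_ge0. Qed.

Lemma one_powR_gt0 p (y : 'rV[R]_N) : 0 < 1 + enorm y `^ p.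
Proof. by rewrite ltr_pwDl// powR_ge0. Qed.

(** Growth exponents can be raised, at the price of a factor 2: for |y| <= 1 the
left-hand side is at most 2, and elsewhere the power is monotone in the
exponent. *)
Lemma ler_one_powR p q (y : 'rV[R]_N) : 0 <= p <= q ->
  1 + enorm y `^ p <= 2 * (1 + enorm y `^ q).
Proof.
move=> /andP[p0 pq].
have q0 : 0 <= enorm y `^ q by exact: powR_ge0.
have [y1|/ltW y1] := leP (enorm y) 1.
  have yp : enorm y `^ p <= 1.
    have := @ge0_ler_powR R p p0 (enorm y) 1.
    by rewrite powR1; apply => //; rewrite nnegrE ?enorm_ge0.
  lra.
have yp : enorm y `^ p <= enorm y `^ q by exact: ler_powR.
lra.
Qed.

Lemma classCW m1 m2 f : (m1 <= m2)%N -> classC m2 f -> classC m1 f.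
Proof.
elim: m2 m1 f => [[]//|m2 IH] [|m1] f /=; first by move=> _ [].
rewrite ltnS => lem [cf df]; split => // i.
by have [? ?] := df i; split => //; exact: IH lem _.
Qed.

Lemma CpmW p m1 m2 f : (m1 <= m2)%N -> Cpm p m2 f -> Cpm p m1 f.
Proof.
move=> lem [cf bf]; split; first exact: classCW cf.
by move=> alpha /leq_trans -/(_ _ lem); exact: bf.
Qed.

Lemma mdegree_cst0 : (mdegree [ffun _ : 'I_N => 0%N] <= 0)%N.
Proof. by rewrite leqn0 sum_nat_eq0; apply/forallP => i; rewrite ffunE. Qed.

Lemma mpartial_deg0 (alpha : {ffun 'I_N -> nat}) f :
  (mdegree alpha <= 0)%N -> mpartial alpha f = f.
Proof.
rewrite leqn0 sum_nat_eq0 => /forallP a0; rewrite /mpartial.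
by elim: (enum 'I_N) => //= i s ->; have /eqP -> := a0 i.
Qed.

(** The zero multi-index is the only one of degree 0, which reduces the
family of bounds to a single one, on the function itself. *)
Lemma Cpm0P p f :
  Cpm p 0 f <-> continuous f /\
    exists C : R, forall y, `|f y| <= C * (1 + enorm y `^ p).
Proof.
split=> [[cf bf]|[cf [C bf]]]; split=> //.
  have [C hC] := bf _ mdegree_cst0.
  by exists C => y; rewrite -[f](mpartial_deg0 _ mdegree_cst0).
by move=> alpha a0; exists C => y; rewrite mpartial_deg0.
Qed.

Lemma Cpm_norm_ge0 p m f : 0 <= Cpm_norm p m f.
Proof.
rewrite /Cpm_norm; set A := [set C | _].
have [->|/set0P A0] := eqVneq A set0; first by rewrite inf0.
by apply: lb_le_inf => // C [].
Qed.

(** The infimum defining the norm is attained: for each y, the quotient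
|f y| / (1 + |y|^p) is a lower bound of the admissible constants. *)
Lemma ler_Cpm_norm p f y : Cpm p 0 f ->
  `|f y| <= Cpm_norm p 0 f * (1 + enorm y `^ p).
Proof.
move=> /Cpm0P[cf [C hC]]; rewrite -ler_pdivrMr ?one_powR_gt0//.
apply: lb_le_inf.
  (* Admissible constants have to be nonnegative, hence the absolute value. *)
  exists `|C|; split => // alpha a0 z; rewrite mpartial_deg0//.
  apply: le_trans (hC z) _.
  by rewrite ler_wpM2r ?ler_norm// ltW ?one_powR_gt0.
move=> D [D0 hD]; rewrite ler_pdivrMr ?one_powR_gt0//.
by have := hD _ mdegree_cst0 y; rewrite mpartial_deg0// mdegree_cst0.
Qed.

Lemma Cpm_Cpoly p m f : 0 <= p -> Cpm p m f -> Cpoly f.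
Proof. by move=> p0 pf; exists p; split => //; exact: CpmW pf. Qed.

Lemma Cpoly_lin (a : R) f g : Cpoly f -> Cpoly g ->
  Cpoly (fun y => a * f y + g y).
Proof.
move=> [p [p0 /Cpm0P[cf [C hC]]]] [q [q0 /Cpm0P[cg [D hD]]]].
exists (Num.max p q); split; first by rewrite le_max p0.
apply/Cpm0P; split.
  by move=> y; exact: cvgD (cvgM (cvg_cst a) (cf y)) (cg y).
exists (`|a| * (`|C| * 2) + `|D| * 2) => y.
have dom E s (u : R) : 0 <= s <= Num.max p q ->
    u <= E * (1 + enorm y `^ s) ->
    u <= `|E| * 2 * (1 + enorm y `^ Num.max p q).
  move=> hs /le_trans; apply.
  apply: (@le_trans _ _ (`|E| * (1 + enorm y `^ s))).
    by rewrite ler_wpM2r ?ler_norm// ltW ?one_powR_gt0.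
  by rewrite -mulrA ler_wpM2l// ler_one_powR.
rewrite mulrDl; apply: le_trans (ler_normD _ _) _; apply: lerD.
  rewrite normrM -mulrA ler_wpM2l//.
  by apply: (dom _ _ _ _ (hC y)); rewrite p0 le_max lexx.
by apply: (dom _ _ _ _ (hD y)); rewrite q0 le_max lexx orbT.
Qed.

Lemma CpolyB f g : Cpoly f -> Cpoly g -> Cpoly (fun y => f y - g y).
Proof.
move=> cf cg; have := Cpoly_lin (-1) cg cf; congr Cpoly.
by apply/funext => y; rewrite mulN1r addrC.
Qed.

Lemma continuous_enorm : continuous (@enorm R N).
Proof.
suff csum : continuous (fun y : 'rV[R]_N => \sum_(i < N) y 0 i ^+ 2).
  by move=> y; exact: continuous_comp (csum y) (@sqrt_continuous R _).
apply: continuous_big => [|i _]; first exact: add_continuous.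
move=> y.
exact: (continuous_comp (@coord_continuous R 1 N 0 i y)
  (@exprn_continuous R 2 _)).
Qed.

Lemma Cpoly_enormX k : Cpoly (fun y : 'rV[R]_N => enorm y ^+ k).
Proof.
exists k%:R; split => //; apply/Cpm0P; split.
  move=> y.
  exact: (continuous_comp (@continuous_enorm y) (@exprn_continuous R k _)).
exists 1 => y; rewrite mul1r ger0_norm ?exprn_ge0 ?enorm_ge0//.
by rewrite powR_mulrn ?enorm_ge0// lerDr.
Qed.

Definition weight (r : nat) (y : 'rV[R]_N) : R := 1 + enorm y ^+ (2 * r).

Lemma weight_ge1 r y : 1 <= weight r y.
Proof. by rewrite lerDl exprn_ge0 ?enorm_ge0. Qed.

Lemma weight_gt0 r y : 0 < weight r y.
Proof. exact: lt_le_trans (weight_ge1 r y). Qed.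

(** This presents the weight as a combination of two of the functions to which
Assumption (M) applies, with exponents r and 0. *)
Lemma weightE r : weight r =
  (fun y => 1 * enorm y ^+ (2 * r) + enorm y ^+ (2 * 0)).
Proof. by apply/funext => y; rewrite /weight mul1r muln0 expr0 addrC. Qed.

Lemma Cpoly_weight r : Cpoly (weight r).
Proof. by rewrite weightE; apply: Cpoly_lin; exact: Cpoly_enormX. Qed.

Lemma one_powR_le_weight q r (y : 'rV[R]_N) :
  0 <= q <= (2 * r)%:R -> 1 + enorm y `^ q <= 2 * weight r y.
Proof.
by move=> /(@ler_one_powR q _ y); rewrite powR_mulrn ?enorm_ge0.
Qed.

End Growth.

(** * Positive linear operators *)

Section PositiveOperators.
Context {R : realType} {N : nat}.
Implicit Types (f g : 'rV[R]_N -> R) (L : ('rV[R]_N -> R) -> 'rV[R]_N -> R).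
Local Notation linear_Cpoly := (linear_from_to (@Cpoly R N) (@Cpoly R N)).

(** Linearity is available only in the form a f + g, and the choice g = 0 would
require L 0 = 0; instead a f is written as a f + (- f + f). *)
Lemma linear_CpolyZ L (a : R) f : linear_Cpoly L -> Cpoly f ->
  L (fun y => a * f y) = (fun y => a * L f y).
Proof.
move=> [LC LL] cf.
have /= L1 := LL (-1) _ _ cf cf.
have /= La := LL a _ _ cf (Cpoly_lin (-1) cf cf).
move: La; rewrite L1.
rewrite (_ : (fun y => a * f y + _) = (fun y => a * f y)); last first.
  by apply/funext => y; rewrite mulN1r addNr addr0.
by move=> ->; apply/funext => y; rewrite mulN1r addNr addr0.
Qed.

Lemma linear_CpolyB L f g : linear_Cpoly L -> Cpoly f -> Cpoly g ->
  L (fun y => f y - g y) = (fun y => L f y - L g y).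
Proof.
move=> [LC LL] cf cg.
transitivity (L (fun y => -1 * g y + f y)).
  by congr L; apply/funext => y; rewrite mulN1r addrC.
by rewrite LL//; apply/funext => y; rewrite mulN1r addrC.
Qed.

(** Apply the order axiom, which speaks of nonnegative functions only, to the
shifted inequality 0 <= f + g <= g + g. *)
Lemma positive_ler_norm L f g : linear_Cpoly L ->
  (forall f g, Cpoly f -> Cpoly g -> (forall y, 0 <= f y <= g y) ->
     forall y, 0 <= L f y <= L g y) ->
  Cpoly f -> Cpoly g -> (forall y, `|f y| <= g y) ->
  forall y, `|L f y| <= L g y.
Proof.
move=> linL posL cf cg fg y; have [LC LL] := linL.
have := posL _ _ (Cpoly_lin 1 cf cg) (Cpoly_lin 1 cg cg) _ y.
rewrite !LL// !mul1r ler_norml => h.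
suff : 0 <= L f y + L g y <= L g y + L g y by move=> /andP[? ?]; lra.
by apply: h => z; have := fg z; rewrite ler_norml !mul1r => /andP[? ?]; lra.
Qed.

End PositiveOperators.

(** * Consistency, stability and their combination *)

Section Scheme.
Context {R : realType} {N : nat} {T : R}.
Variables P Q : R -> ('rV[R]_N -> R) -> 'rV[R]_N -> R.
Hypotheses (famP : operator_family T P) (famQ : operator_family T Q).

(** Add the growth bounds of Assumption (M) for f_r and for f_0 = 1. The
additive constants K' t are absorbed because the weight is at least 1. *)
Lemma weight_growth (MQ : assumption_M T Q) r :
  exists L : R, 0 <= L /\ forall (t : R) y, t \in `[0, T] ->
    Q t (weight r) y <= (1 + L * t) * weight r y.
Proof.
have [K [K' [K0 K'0 hK]]] := MQ.2 r; have [J [J' [J0 J'0 hJ]]] := MQ.2 0%N.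
exists (K + K' + J + J'); split; first by lra.
move=> t y tT; have t0 : 0 <= t by move: tT; rewrite in_itv => /andP[].
rewrite weightE (famQ tT).2; [|exact: Cpoly_enormX..].
have := hJ t y tT; have := hK t y tT; rewrite muln0 expr0 !mul1r.
have := exprn_ge0 (2 * r) (enorm_ge0 y); set e := enorm y ^+ _ => e0 h1 h2.
have a1 : 0 <= (K' + J + J') * (t * e) by rewrite !mulr_ge0//; lra.
have a2 : 0 <= K * t by rewrite mulr_ge0// ltW.
lra.
Qed.

(** Stability: one step of the scheme costs a factor 1 + L t in the weighted
sup norm. *)
Lemma weight_step (MQ : assumption_M T Q) r (L t c : R) f :
  (forall y, Q t (weight r) y <= (1 + L * t) * weight r y) ->
  t \in `[0, T] -> Cpoly f -> 0 <= c ->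
  (forall y, `|f y| <= c * weight r y) ->
  forall y, `|Q t f y| <= c * (1 + L * t) * weight r y.
Proof.
move=> QL tT cf c0 fc y.
have cw : Cpoly (fun z : 'rV[R]_N => c * weight r z).
  have := Cpoly_lin (c - 1) (Cpoly_weight r) (@Cpoly_weight R N r).
  by congr Cpoly; apply/funext => z; ring.
apply: (@le_trans _ _ (Q t (fun z => c * weight r z) y)).
  apply: positive_ler_norm => //; first exact: famQ.
  by move=> u v cu cv uv z; apply: MQ.1.2.
rewrite linear_CpolyZ; [|exact: famQ|exact: Cpoly_weight].
by rewrite -mulrA ler_wpM2l.
Qed.

(** Induction on n with the recursion D_{n+1} = (P_h - Q_h) P_{nh} f + Q_h D_n.
The powers (1 + L h)^k attached to the successive one-step errors are all
majorized by the last one, which replaces a geometric sum by n terms. *)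
Lemma semigroup_iter_error (MQ : assumption_M T Q) (sgP : semigroup T P)
    r (L h eps : R) n f :
  (forall y, Q h (weight r) y <= (1 + L * h) * weight r y) ->
  0 <= L -> 0 <= h -> 0 <= eps -> n%:R * h <= T -> Cpoly f ->
  (forall k y, (k < n)%N ->
    `|P h (P (k%:R * h) f) y - Q h (P (k%:R * h) f) y| <= eps * weight r y) ->
  forall y, `|P (n%:R * h) f y - iter n (Q h) f y| <=
    n%:R * eps * (1 + L * h) ^+ n * weight r y.
Proof.
move=> QL L0 h0 eps0 + cf.
have Lh : 1 <= 1 + L * h by rewrite lerDl mulr_ge0.
elim: n => [|n IH] nT loc y.
  by rewrite !mul0r /= sgP.1// subrr normr0.
have nT' : n%:R * h <= T.
  by apply: le_trans nT; rewrite ler_wpM2r// ler_nat.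
have hT : h \in `[0, T].
  rewrite in_itv /= h0; apply: le_trans nT.
  by rewrite -[leLHS]mul1r ler_wpM2r// ler1n.
have nhT : n%:R * h \in `[0, T] by rewrite in_itv /= mulr_ge0.
have IHn := IH nT' (fun k y kn => loc k y (ltnW kn)).
have cQ k : Cpoly (iter k (Q h) f) by elim: k => //= k; exact: (famQ hT).1.
have cP := (famP nhT).1 _ cf.
have eqS : n.+1%:R * h = h + n%:R * h by rewrite -natr1 mulrDl mul1r addrC.
rewrite eqS sgP.2// -?eqS ?in_itv /= ?mulr_ge0//.
have -> : P h (P (n%:R * h) f) y - Q h (iter n (Q h) f) y =
    (P h (P (n%:R * h) f) y - Q h (P (n%:R * h) f) y) +
    Q h (fun z => P (n%:R * h) f z - iter n (Q h) f z) y.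
  rewrite linear_CpolyB//; last exact: famQ.
  by ring.
apply: le_trans (ler_normD _ _) _.
have c0 : 0 <= n%:R * eps * (1 + L * h) ^+ n.
  by rewrite !mulr_ge0// exprn_ge0//; lra.
have := weight_step MQ QL hT (CpolyB cP (cQ n)) c0 IHn y.
have := loc n y (ltnSn n).
set E := eps * _; set F := `|Q h _ y| => EE FF.
apply: le_trans (lerD EE FF) _; rewrite /E -mulrDl.
rewrite ler_wpM2r ?(ltW (weight_gt0 _ _))//.
(* eps + n eps (1 + L h)^{n+1} <= (n + 1) eps (1 + L h)^{n+1} *)
rewrite -natr1 [in leRHS]mulrDl mul1r mulrDl addrC -!mulrA -exprSr lerD2l.
by rewrite ler_peMr// exprn_ege1.
Qed.

(** Consistency: the two expansions to order m have equal polynomial parts, so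
that only the two remainders are left. Their growth exponents may differ; r is
chosen to dominate both. *)
Lemma local_error m (delta : R -> R)
    (eP eQ : R -> nat -> ('rV[R]_N -> R) -> 'rV[R]_N -> R) (p : R) :
  (1 <= m)%N -> (forall t : R, t \in `[0, T] -> 0 <= delta t) -> 2 <= p ->
  assumption_R T m delta P eP -> assumption_R T m delta Q eQ ->
  (forall (t : R) f, t \in `[0, T] -> Cpm p (2 * m) f ->
     Jle m (eP p) t f = Jle m (eQ p) t f) ->
  exists K r, 0 < K /\
    forall t f y, t \in `[0, T] -> Cpm p (2 * m.+1) f ->
    `|P t f y - Q t f y| <=
      K * (t * delta t) * Cpm_norm p (2 * m.+1) f * weight r y.
Proof.
move=> m1 delta0 p2 RP RQ eqJ.
have err (S : R -> ('rV[R]_N -> R) -> 'rV[R]_N -> R) e :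
    assumption_R T m delta S e -> exists K q,
    [/\ 0 < K, 0 <= q & forall t f y, t \in `[0, T] -> Cpm p (2 * m.+1) f ->
      `|Err S (e p) m t f y| <=
        K * (t * delta t) * Cpm_norm p (2 * m.+1) f * (1 + enorm y `^ q)].
  move=> /(_ p p2)[q [pq [_ errC errN _]]].
  have [K [K0 _ hK]] := errN (2 * m.+1)%N.
  exists K, q; split => //; first by lra.
  move=> t f y tT cf.
  have m1m : (1 <= m <= m)%N by rewrite m1 leqnn.
  apply: le_trans (ler_Cpm_norm y (errC _ _ _ m1m cf tT)) _.
  rewrite ler_wpM2r ?(ltW (one_powR_gt0 _ _))//.
  have := hK m f t m1m _ cf tT; rewrite ltnn; apply.
  by rewrite mulnS addnC.
have [KP [qP [KP0 qP0 hP]]] := err _ _ RP.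
have [KQ [qQ [KQ0 qQ0 hQ]]] := err _ _ RQ.
pose r := (Num.truncn (qP + qQ)).+1.
have rq : qP + qQ <= (2 * r)%:R.
  apply: (@le_trans _ _ r%:R); last by rewrite ler_nat leq_pmull.
  by rewrite ltW// truncnS_gt.
exists (2 * (KP + KQ)), r; split; first by lra.
move=> t f y tT cf.
have t0 : 0 <= t by move: tT; rewrite in_itv => /andP[].
have -> : P t f y - Q t f y = Err P (eP p) m t f y - Err Q (eQ p) m t f y.
  rewrite /Err eqJ//; first by ring.
  by apply: CpmW cf; rewrite leq_mul2l leqnSn.
have c0 : 0 <= t * delta t * Cpm_norm p (2 * m.+1) f.
  by rewrite !mulr_ge0 ?delta0 ?Cpm_norm_ge0.
have dom K q (u : R) : 0 < K -> 0 <= q <= (2 * r)%:R ->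
    u <= K * (t * delta t) * Cpm_norm p (2 * m.+1) f * (1 + enorm y `^ q) ->
    u <= K * (t * delta t) * Cpm_norm p (2 * m.+1) f * (2 * weight r y).
  move=> K0 hq /le_trans; apply; apply: ler_wpM2l.
    by rewrite -mulrA; apply: mulr_ge0 c0; exact: ltW.
  exact: one_powR_le_weight.
have qPr : 0 <= qP <= (2 * r)%:R by lra.
have qQr : 0 <= qQ <= (2 * r)%:R by lra.
have eP' := dom _ _ _ KP0 qPr (hP t f y tT cf).
have eQ' := dom _ _ _ KQ0 qQr (hQ t f y tT cf).
apply: le_trans (ler_normB _ _) _; apply: le_trans (lerD eP' eQ') _.
by rewrite le_eqVlt; apply/orP; left; apply/eqP; ring.
Qed.

End Scheme.

Theorem theorem4p1 (R : realType) (N : nat) (T : R) (m : nat)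
    (delta : R -> R)
    (P Q : R -> ('rV[R]_N -> R) -> 'rV[R]_N -> R)
    (eP eQ : R -> nat -> ('rV[R]_N -> R) -> 'rV[R]_N -> R) :
  (1 <= N)%N -> 0 < T -> (1 <= m)%N ->
  admissible_rate T m delta ->
  operator_family T P -> operator_family T Q ->
  semigroup T P -> assumption_MP T P ->
  assumption_M T P -> assumption_M T Q ->
  assumption_R T m delta P eP -> assumption_R T m delta Q eQ ->
  (forall (p t : R) (f : 'rV[R]_N -> R),
     2 <= p -> t \in `[0, T] -> Cpm p (2 * m) f ->
     Jle m (eP p) t f = Jle m (eQ p) t f) ->
  forall (p : R) (x : 'rV[R]_N), 2 <= p ->
  exists K : R, 0 < K /\
    forall f : 'rV[R]_N -> R, Cpm p (2 * m.+1) f ->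
    forall n : nat, (1 <= n)%N ->
      `|P T f x - iter n (Q (T / n%:R)) f x|
        <= K * delta (T / n%:R) * Cpm_norm p (2 * m.+1) f.
Proof.
move=> N1 T0 m1 [delta0 _ _] famP famQ sgP MP _ MQ RP RQ eqJ p x p2.
have eqJp t f := eqJ p t f p2.
have [K [r [K0 loc]]] := local_error m1 delta0 p2 RP RQ eqJp.
have [L [L0 grow]] := weight_growth famQ MQ r.
have [C [C0 hC]] := MP p (2 * m.+1)%N p2 (leq_pmulr 2 (ltn0Sn m)).
exists (T * K * C * expR (L * T) * weight r x); split.
  by rewrite !mulr_gt0// ?expR_gt0 ?weight_gt0.
move=> f cf n n1; set h := T / n%:R.
have n0 : 0 < n%:R :> R by rewrite ltr0n.
have nh : n%:R * h = T by rewrite /h mulrC divfK// gt_eqF.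
have h0 : 0 <= h by rewrite divr_ge0 ?ltW.
clearbody h.
have hT k : (k <= n)%N -> k%:R * h \in `[0, T].
  by move=> kn; rewrite in_itv /= mulr_ge0//= -nh ler_wpM2r// ler_nat.
have h1 : h \in `[0, T] by rewrite -[h]mul1r; exact: (hT 1%N n1).
have [_ bdP _] := hC f cf.
set F := Cpm_norm p (2 * m.+1) f.
have F0 : 0 <= F := Cpm_norm_ge0 _ _ _.
pose eps := K * (h * delta h) * (C * F).
have Kh0 : 0 <= K * (h * delta h) by rewrite pmulr_rge0 ?mulr_ge0 ?delta0.
have eps0 : 0 <= eps by rewrite mulr_ge0// mulr_ge0// ltW.
have step k y : (k < n)%N ->
    `|P h (P (k%:R * h) f) y - Q h (P (k%:R * h) f) y| <= eps * weight r y.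
  move=> /ltnW/hT /bdP [cPf nPf]; apply: le_trans (loc h _ y h1 cPf) _.
  by rewrite ler_wpM2r ?(ltW (weight_gt0 _ _))// ler_wpM2l.
have cf0 : Cpoly f by apply: (Cpm_Cpoly _ cf); lra.
have nT : n%:R * h <= T by rewrite nh.
have := semigroup_iter_error famP famQ MQ sgP (fun y => grow h y h1)
  L0 h0 eps0 nT cf0 step x.
rewrite nh => /le_trans; apply.
have expn : (1 + L * h) ^+ n <= expR (L * T).
  have -> : expR (L * T) = expR (L * h) ^+ n.
    by rewrite -expRM_natl -nh mulrCA.
  apply: lerXn2r; rewrite ?nnegrE ?expR_ge0 ?expR_ge1Dx//.
  by rewrite addr_ge0 ?mulr_ge0.
have -> : T * K * C * expR (L * T) * weight r x * delta h * F =
    n%:R * eps * expR (L * T) * weight r x by rewrite -nh /eps; ring.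
rewrite ler_wpM2r ?(ltW (weight_gt0 _ _))// ler_wpM2l// mulr_ge0//.
Qed.
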